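(* Let $\mathcal{F}$ be the set of paths $P\in\mathcal{E}$ such that either (i) $P=(UD)^k$ for some $k\ge 0$, or (ii) $P=(UD)^{\ell_0}U^{k_1}\alpha_1U^{k_2}\alpha_2\cdots U^{k_r}\alpha_r$ where $r\ge 1$, $\ell_0\ge 0$, $k_i\ge 2$ for $1\le i\le r$, each $\alpha_i$ with $1\le i\le r-1$ is either $(DU)^kD$ or $(DU)^kDD$ for some $k\ge 0$, and $\alpha_r$ is either $(DU)^kC_s$ or $(DU)^kDC_s$ for some $k\ge 0$, where $s\ge 1$ is such that the path ends on the $x$-axis (with the convention $C_1=D$). The ordinary generating function $F(x)=\sum_{P\in\mathcal{F}}x^{|P|}$ of $\mathcal{F}$ with respect to the length is $$F(x)=\frac{x-1}{(x+1)(x^3-x^2+2x-1)},$$ and its series expansion is $$1+x^2+x^3+3x^4+4x^5+8x^6+13x^7+24x^8+41x^9+73x^{10}+127x^{11}+O(x^{12}).$$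
   Context: A Dyck path with catastrophes is a finite lattice path in the first quadrant ($y\ge 0$) starting at the origin, ending on the $x$-axis, with steps $U=(1,1)$, $D=(1,-1)$ and catastrophe steps $C_k=(1,-k)$, $k\ge 2$, where a catastrophe step must end on the $x$-axis (so $C_k$ can only be used from height $k$). By convention $C_1=D$. $\mathcal{E}$ is the set of all Dyck paths with catastrophes (including the empty path). The length $|P|$ is the number of steps of $P$; paths are written as words in the steps. Generating functions are formal power series in $x$. *)

(* Defs.v *)
From HB Require Import structures.
From mathcomp Require Import all_boot all_order all_algebra.
From mathcomp Require Import finmap all_classical.

Set Implicit Arguments.
Unset Strict Implicit.
Unset Printing Implicit Defensive.

Import Order.TTheory GRing.Theory Num.Theory.
Local Open Scope classical_set_scope.
Local Open Scope ring_scope.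

(* Formal power series over R, as coefficient sequences. *)
Definition fps (R : Type) := nat -> R.

Section FormalPowerSeries.
Variable R : comUnitRingType.
Implicit Types f g : fps R.

Definition fps_of_poly (p : {poly R}) : fps R := fun n => p`_n.

Definition fps_mul f g : fps R := fun n => \sum_(i < n.+1) f i * g (n - i)%N.

(* The first n coefficients of 1 / f, obtained by solving f * g = 1 for the
   coefficients of g one after the other. *)
Fixpoint fps_inv_coefs f (n : nat) : seq R :=
  if n is m.+1 then
    let s := fps_inv_coefs f m in
    rcons s ((f 0%N)^-1 * ((m == 0%N)%:R - \sum_(i < m) s`_i * f (m - i)%N))
  else [::].

(* Only meaningful if f 0 is a unit, see fps_mulV. *)
Definition fps_inv f : fps R := fun n => (fps_inv_coefs f n.+1)`_n.

Definition fps_div f g : fps R := fps_mul f (fps_inv g).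

Definition fps_eq_mod (N : nat) f g : Prop :=
  forall n, (n < N)%N -> f n = g n.

Lemma size_fps_inv_coefs f n : size (fps_inv_coefs f n) = n.
Proof. by elim: n => //= n IHn; rewrite size_rcons IHn. Qed.

Lemma nth_fps_inv_coefs f n i :
  (i < n)%N -> (fps_inv_coefs f n)`_i = fps_inv f i.
Proof.
elim: n => // n IHn; rewrite ltnS leq_eqVlt => /orP[/eqP-> // | lt_in].
by rewrite /= nth_rcons size_fps_inv_coefs lt_in IHn.
Qed.

Lemma fps_mulV f : f 0%N \is a GRing.unit ->
  fps_mul (fps_inv f) f = fps_of_poly 1.
Proof.
move=> Uf; apply/funext => n; rewrite /fps_mul /fps_of_poly coef1.
rewrite big_ord_recr /= subnn {2}/fps_inv /= nth_rcons size_fps_inv_coefs.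
rewrite ltnn eqxx mulrAC mulVr // mul1r addrC.
rewrite [X in _ - X + _](eq_bigr (fun i : 'I_n => fps_inv f i * f (n - i)%N));
  first by rewrite subrK.
by move=> i _; rewrite nth_fps_inv_coefs.
Qed.

End FormalPowerSeries.

(* Cat k stands for the catastrophe C_k; only k >= 2 is allowed in a path. *)
Inductive step := U | D | Cat of nat.

Definition step_code (s : step) : nat :=
  match s with U => 0 | D => 1 | Cat k => k.+2 end.
Definition step_decode (n : nat) : step :=
  match n with 0 => U | 1 => D | k.+2 => Cat k end.
Lemma step_codeK : cancel step_code step_decode. Proof. by case. Qed.
HB.instance Definition _ := Countable.copy step (can_type step_codeK).

Definition word := seq step.

(* C_k, with the convention C_1 = D. *)
Definition C (k : nat) : step := if k == 1%N then D else Cat k.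

Definition rise (s : step) : int :=
  match s with U => 1 | D => -1 | Cat k => - k%:Z end.

(* Ordinate of the end point of the path. *)
Definition height (P : word) : int := \sum_(s <- P) rise s.

Definition dyck_catastrophes : set word := [set P : word |
  [/\ forall n, 0 <= height (take n P),
      height P = 0
    & forall P1 k P2, P = P1 ++ Cat k :: P2 ->
        (2 <= k)%N /\ height (rcons P1 (Cat k)) = 0]].

(* The concatenation power w^k. *)
Definition wpow (w : word) (k : nat) : word := flatten (nseq k w).

Definition inner_factor (a : word) : Prop :=
  exists k, a = wpow [:: D; U] k ++ [:: D] \/
            a = wpow [:: D; U] k ++ [:: D; D].

Definition last_factor (a : word) : Prop :=
  exists k s, (1 <= s)%N /\
    (a = wpow [:: D; U] k ++ [:: C s] \/ a = wpow [:: D; U] k ++ [:: D; C s]).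

Definition form1 (P : word) : Prop := exists k, P = wpow [:: U; D] k.

(* The condition that s makes the path end on the x-axis is imposed by
   membership in dyck_catastrophes. *)
Definition form2 (P : word) : Prop :=
  exists (r l0 : nat) (k : nat -> nat) (alpha : nat -> word),
  [/\ (1 <= r)%N,
      forall i, (1 <= i <= r)%N -> (2 <= k i)%N,
      forall i, (1 <= i <= r.-1)%N -> inner_factor (alpha i),
      last_factor (alpha r)
    & P = wpow [:: U; D] l0 ++
          \big[cat/[::]]_(1 <= i < r.+1) (nseq (k i) U ++ alpha i)].

Definition calF : set word :=
  [set P | dyck_catastrophes P /\ (form1 P \/ form2 P)].

Definition of_length (A : set word) (n : nat) : set word :=
  [set P | A P /\ size P = n].

(* Ordinary generating function of A with respect to the length. The
   cardinality is a genuine one when A is a set of Dyck paths with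
   catastrophes, by finite_of_length. *)
Definition ogf (A : set word) : fps int :=
  fun n => (#|` fset_set (of_length A n)|)%:Z.

Lemma height_le_size (P : word) : height P <= (size P)%:Z.
Proof.
rewrite /height; elim: P => [|s P IHP]; first by rewrite big_nil.
rewrite big_cons /= intS lerD //.
by case: s => //= k; rewrite lerNl (le_trans (y := 0)) // lerN10.
Qed.

Lemma finite_of_length (A : set word) (n : nat) :
  A `<=` dyck_catastrophes -> finite_set (of_length A n).
Proof.
move=> subAE.
pose code (t : n.-tuple 'I_n.+3) : word := [seq step_decode (val i) | i <- t].
apply: (@sub_finite_set _ _ (code @` setT)); last first.
  by apply: finite_image; exact: finite_finset.
move=> P [/subAE[_ _ catP] szP].
have bound s : s \in P -> (step_code s < n.+3)%N.
  move=> sP; case: s sP => // k sP; case/splitPr: sP catP szP => P1 P2 catP szP.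
  have [_] := catP _ _ _ erefl.
  rewrite /height big_rcons /= => /eqP.
  rewrite subr_eq0 => /eqP hk.
  have := height_le_size P1; rewrite /height hk lez_nat => le_k.
  rewrite !ltnS (leq_trans le_k) // -szP size_cat leq_addr //.
have sz : size [seq inord (step_code s) : 'I_n.+3 | s <- P] == n.
  by rewrite size_map szP.
exists (Tuple sz) => //.
rewrite /code /= -map_comp -[RHS]map_id; apply/eq_in_map => s sP /=.
by rewrite inordK ?step_codeK // bound.
Qed.

(* Main.v *)
(* Read from left to right, a nonempty path of the family is a word v over
   {U, D} accepted by a finite automaton, followed by one step C_s whose index
   is forced to be the height of v. Counting accepted words gives
   a(n+5) = a(n+4) + a(n+3) + a(n+1), and the denominator of F is
   x^4 + x^2 + x - 1. *)
Require Import Defs.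
From mathcomp Require Import all_boot all_order all_algebra.
From mathcomp Require Import all_classical.
From mathcomp Require Import finmap zify ring.

Import GRing.Theory.
Local Open Scope ring_scope.

(** * Ring laws and division for formal power series *)

Section FpsAlgebra.
Variable R : comUnitRingType.
Implicit Types f g h : fps R.

Definition fps_trunc (n : nat) f : {poly R} := \poly_(i < n.+1) f i.

(** Coefficients up to [n] see only the truncations, so commutativity and associativity are
    inherited from polynomials. *)
Lemma fps_mul_trunc n f g m : (m <= n)%N ->
  fps_mul f g m = (fps_trunc n f * fps_trunc n g)`_m.
Proof.
move=> le_mn; rewrite coefM; apply: eq_bigr => i _.
have le_im : (i <= m)%N by rewrite -ltnS.
by rewrite !coef_poly !ltnS (leq_trans le_im le_mn) (leq_trans (leq_subr _ _) le_mn).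
Qed.

Lemma fps_mulC f g : fps_mul f g = fps_mul g f.
Proof.
by apply/funext => n; rewrite !(@fps_mul_trunc n) // mulrC.
Qed.

Lemma fps_mulA f g h : fps_mul f (fps_mul g h) = fps_mul (fps_mul f g) h.
Proof.
apply/funext => n.
transitivity ((fps_trunc n f * (fps_trunc n g * fps_trunc n h))`_n).
  rewrite coefM; apply: eq_bigr => i _.
  by rewrite coef_poly ltn_ord (@fps_mul_trunc n) // leq_subr.
rewrite mulrA coefM; apply: eq_bigr => i _.
by rewrite coef_poly ltnS leq_subr (@fps_mul_trunc n) // -ltnS.
Qed.

Lemma fps_mulr1 f : fps_mul f (fps_of_poly 1) = f.
Proof.
apply/funext => n; rewrite /fps_mul /fps_of_poly big_ord_recr /= subnn coef1 mulr1.
rewrite big1 ?add0r // => i _.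
by rewrite coef1 subn_eq0 leqNgt ltn_ord mulr0.
Qed.

(** Reduces a quotient to a product identity, which can be checked coefficientwise without computing
    an inverse series. *)
Lemma fps_divP f g h : g 0%N \is a GRing.unit ->
  fps_mul f g = h -> f = fps_div h g.
Proof.
move=> Ug <-.
by rewrite /fps_div -fps_mulA [fps_mul g _]fps_mulC fps_mulV // fps_mulr1.
Qed.

End FpsAlgebra.

(* Ground and Odd read the prefix (UD)^l, stopping at height 0 and 1. Run means
   at least two U's, or a block followed by (DU)^k; Down means that the last
   step was the first D after Run. Two consecutive D's must be followed by two
   U's, whence Low and LowU. *)
Inductive state := Ground | Odd | Run | Down | Low | LowU.

Fixpoint accepts (q : state) (v : word) : bool :=
  match q, v with
  | (Odd | Run | Down), [::] => true
  | Ground, U :: v' => accepts Odd v'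
  | Odd, U :: v' => accepts Run v'
  | Odd, D :: v' => accepts Ground v'
  | Run, U :: v' => accepts Run v'
  | Run, D :: v' => accepts Down v'
  | Down, U :: v' => accepts Run v'
  | Down, D :: v' => accepts Low v'
  | Low, U :: v' => accepts LowU v'
  | LowU, U :: v' => accepts Run v'
  | _, _ => false
  end.

(** * Heights along accepted words, and closing these words into paths *)

Definition min_height (q : state) : int :=
  match q with
  | Ground => 0 | Odd => 1 | Run => 2 | Down => 1 | Low => 0 | LowU => 1
  end.

Lemma height_nil : height [::] = 0.
Proof. exact: big_nil. Qed.

Lemma height_cons s v : height (s :: v) = rise s + height v.
Proof. exact: big_cons. Qed.

Lemma height_rcons v s : height (rcons v s) = height v + rise s.
Proof. by rewrite /height big_rcons /= addrC. Qed.

Lemma rise_C s : rise (C s) = - s%:Z.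
Proof. by rewrite /C; case: eqP => [->|]. Qed.

(** [min_height] is an invariant: reading [s] leads from [q] to a state whose bound is at most
    [min_height q + rise s]. All bounds are nonnegative, and those of the accepting states are at
    least 1. *)
Lemma accepts_height q v (h : int) : accepts q v -> min_height q <= h ->
  (forall n, 0 <= h + height (take n v)) /\ 1 <= h + height v.
Proof.
elim: v q h => [|s v IHv] q h.
  by case: q => //= _ hq; split=> [n|]; rewrite height_nil; lia.
have step q' : accepts q' v -> min_height q' <= h + rise s -> 0 <= h ->
    (forall n, 0 <= h + height (take n (s :: v))) /\ 1 <= h + height (s :: v).
  move=> acc_v /(IHv _ _ acc_v)[pos_v end_v] h_ge0.
  rewrite height_cons addrA; split=> // -[|n] /=.
    by rewrite height_nil addr0.
  by rewrite height_cons addrA.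
by case: q s step => -[|| k] //= step acc_v hq; apply: step acc_v _ _ => /=; lia.
Qed.

Lemma accepts_no_Cat q v k : accepts q v -> Cat k \notin v.
Proof.
elim: v q => // s v IHv q acc_v.
have no_Cat q' : accepts q' v -> s <> Cat k -> Cat k \notin s :: v.
  move=> /IHv kv sk; rewrite inE negb_or kv andbT.
  by apply/eqP => /esym.
by case: q s acc_v no_Cat => -[|| j] //= acc_v; apply; try exact: acc_v.
Qed.

(** The absolute value only turns the height into a natural number: a word accepted from [Ground]
    has height at least 1. *)
Definition close_path (v : word) : word := rcons v (C `|height v|%N).

Lemma close_path_inj : injective close_path.
Proof. by move=> v w /rcons_inj[]. Qed.

Lemma close_path_dyck v : accepts Ground v -> dyck_catastrophes (close_path v).
Proof.
move=> acc_v; have [pos_v] := accepts_height _ _ 0 acc_v isT.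
rewrite add0r => end_v.
have end0 : height (close_path v) = 0.
  by rewrite height_rcons rise_C; lia.
split=> // [n|P1 k P2].
  rewrite /close_path -cats1 take_cat; case: ltnP => _.
    by have := pos_v n; rewrite add0r.
  case: (n - _)%N => [|m] /=; first by rewrite cats0; lia.
  by rewrite cats1 end0.
(* If nothing follows [Cat k], it is the closing step, and its index is not 1 because [C 1] is [D].
   Otherwise it would lie inside [v], which contains no catastrophe. *)
case/lastP: P2 => [|P2 s].
  rewrite cats1 => eqP; rewrite -eqP end0; split=> //.
  case/rcons_inj: eqP => _; rewrite /C; case: eqP => // ne1 [<-].
  by lia.
rewrite -rcons_cons -rcons_cat => /rcons_inj[def_v _].
have := accepts_no_Cat _ _ k acc_v.
by rewrite def_v mem_cat inE eqxx orbT.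
Qed.

(** * Block decompositions as an inductive family *)

(** Replaces the indexed concatenation of [form2], so that blocks can be peeled off from the left,
    in the order in which the automaton reads them. *)
Inductive blocks : word -> Prop :=
| BlocksLast k a : (2 <= k)%N -> last_factor a -> blocks (nseq k U ++ a)
| BlocksCons k a w : (2 <= k)%N -> inner_factor a -> blocks w ->
    blocks (nseq k U ++ a ++ w).

Lemma form2P P : form2 P <-> exists l w, blocks w /\ P = wpow [:: U; D] l ++ w.
Proof.
split=> [[r [l [k [alpha [r_gt0 k_ge2 inner last ->]]]]]|[l [w [Bw ->]]]].
  exists l; eexists; split; last by [].
  case: r r_gt0 k_ge2 inner last => // r _ k_ge2 inner last.
  elim: r k alpha k_ge2 inner last => [|r IHr] k alpha k_ge2 inner last.
    by rewrite big_nat1; apply: BlocksLast; [apply: k_ge2|].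
  rewrite big_nat_recl // -catA; apply: BlocksCons; [exact: k_ge2|exact: inner|].
  (* Once the first block is removed, the others start at index 2, hence the shift of both
     families. *)
  by apply: (IHr (k \o S) (alpha \o S)) => //= i /andP[i1 i2];
    [apply: k_ge2|apply: inner]; lia.
suff [r [k [alpha [r_gt0 k_ge2 inner last def_w]]]] : exists r k alpha,
  [/\ (1 <= r)%N,
      forall i, (1 <= i <= r)%N -> (2 <= k i)%N,
      forall i, (1 <= i <= r.-1)%N -> inner_factor (alpha i),
      last_factor (alpha r)
    & w = \big[cat/[::]]_(1 <= i < r.+1) (nseq (k i) U ++ alpha i)].
  by exists r, l, k, alpha; split=> //; rewrite def_w.
elim: Bw => [k a k_ge2 last|k a {}w k_ge2 inner_a _ [r [k' [alpha]]]].
  exists 1%N, (fun=> k), (fun=> a); split=> //; last by rewrite big_nat1.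
  by case.
move=> [r_gt0 k_ge2' inner last ->].
(* The new block takes index 1 and moves the others up by one. *)
exists r.+1, (fun i => if i == 1%N then k else k' i.-1),
  (fun i => if i == 1%N then a else alpha i.-1).
split=> //.
- move=> [|[|i]] //= lt_ir; exact: k_ge2'.
- move=> [|[|i]] //= lt_ir; apply: inner; lia.
- by case: r r_gt0 {k_ge2' inner} last.
rewrite [RHS]big_nat_recl //= catA; congr (_ ++ _).
by apply: eq_big_nat => -[].
Qed.

(** * From block decompositions to accepted words *)

Lemma wpowS w k : wpow w k.+1 = w ++ wpow w k.
Proof. by []. Qed.

(** The states reached after the prefix [(UD)^l], after [(DU)^k D] and after [(DU)^k DD]; from each
    of them two [U]s lead to [Run]. *)
Definition block_start (q : state) : bool :=
  if q is (Ground | Down | Low) then true else false.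

Lemma accepts_nseqU q k v : (2 <= k)%N -> block_start q ->
  accepts q (nseq k U ++ v) = accepts Run v.
Proof.
case: k => [|[|k]] // _.
have accRun : accepts Run (nseq k U ++ v) = accepts Run v by elim: k.
by case: q.
Qed.

Lemma accepts_wpowDU k v : accepts Run (wpow [:: D; U] k ++ v) = accepts Run v.
Proof. by elim: k. Qed.

Lemma accepts_wpowUD k v :
  accepts Ground (wpow [:: U; D] k ++ v) = accepts Ground v.
Proof. by elim: k. Qed.

(** All block starts are treated at once, because an inner factor leaves the automaton in [Down] or
    [Low] according to whether it ends in one or two [D]s. *)
Lemma blocks_accepts w : blocks w ->
  exists v s, w = rcons v (C s) /\ forall q, block_start q -> accepts q v.
Proof.
elim=> {w} [k a k_ge2 [j [s [_ def_a]]]|k a w k_ge2 [j def_a] _ [v [s [-> acc_v]]]].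
  case: def_a => ->.
    exists (nseq k U ++ wpow [:: D; U] j), s; split; first by rewrite cats1 rcons_cat.
    move=> q q_start; rewrite accepts_nseqU //.
    by rewrite -[wpow _ _]cats0 accepts_wpowDU.
  exists (nseq k U ++ wpow [:: D; U] j ++ [:: D]), s; split.
    by rewrite !rcons_cat.
  by move=> q q_start; rewrite accepts_nseqU // accepts_wpowDU.
exists (nseq k U ++ a ++ v), s; split; first by rewrite !rcons_cat.
move=> q q_start; rewrite accepts_nseqU //.
by case: def_a => ->; rewrite -catA accepts_wpowDU /= acc_v.
Qed.

(** * From accepted words to block decompositions *)

(** What remains of a decomposition after the [U]s that open a block. *)
Inductive factor_then_blocks : word -> Prop :=
| LastFactor a : last_factor a -> factor_then_blocks a
| InnerFactor a w : inner_factor a -> blocks w -> factor_then_blocks (a ++ w).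

Lemma blocks_run k w : (2 <= k)%N -> factor_then_blocks w ->
  blocks (nseq k U ++ w).
Proof.
move=> k_ge2 [a last_a|a {}w inner_a Bw]; first exact: BlocksLast.
exact: BlocksCons.
Qed.

Lemma factor_then_blocks_DU w : factor_then_blocks w ->
  factor_then_blocks [:: D, U & w].
Proof.
case=> [a [k [s [s_gt0 def_a]]]|a {}w [k def_a] Bw].
  apply: LastFactor; exists k.+1, s; split=> //.
  by case: def_a => ->; [left|right].
apply: (@InnerFactor [:: D, U & a]) => //; exists k.+1.
by case: def_a => ->; [left|right].
Qed.

(** The transitions link the four states, so they share one induction. The prepended [D] or [U] is
    the letter already read of an unfinished factor or block; in [Run], [j] counts the [U]s still to
    come in the current run. *)
Lemma accepts_blocks s v : (1 <= s)%N ->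
  [/\ accepts Run v ->
        exists j w, factor_then_blocks w /\ rcons v (C s) = nseq j U ++ w,
      accepts Down v -> factor_then_blocks (D :: rcons v (C s)),
      accepts Low v -> blocks (rcons v (C s))
    & accepts LowU v -> blocks (U :: rcons v (C s))].
Proof.
move=> s_gt0; elim: v => [|t v [IHrun IHdown IHlow IHlowU]].
  split=> // _; last by apply: LastFactor; exists 0%N, s; split=> //; right.
  by exists 0%N, [:: C s]; split=> //; apply: LastFactor; exists 0%N, s; split=> //; left.
case: t => [||k]; split=> //=.
- by case/IHrun=> j [w [Fw ->]]; exists j.+1, w.
(* A single [U] after the [D] continues the factor as [DU]; with two or more, the [D] is a complete
   inner factor and a new block opens. *)
- case/IHrun=> -[|j] [w [Fw ->]]; first exact: factor_then_blocks_DU.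
  apply: (@InnerFactor [:: D] (nseq j.+2 U ++ w)); first by exists 0%N; left.
  exact: blocks_run.
- by case/IHrun=> j [w [Fw ->]]; apply: (@blocks_run j.+2).
- by move/IHdown=> Fw; exists 0%N, (D :: rcons v (C s)).
- move/IHlow; apply: (@InnerFactor [:: D; D]).
  by exists 0%N; right.
Qed.

Lemma accepts_ground v : accepts Ground v ->
  (exists l, v = wpow [:: U; D] l ++ [:: U]) \/
  forall s, (1 <= s)%N -> form2 (rcons v (C s)).
Proof.
(* Induction on the length, since a leading [UD] removes two letters at a time; a leading [UU] opens
   the first block. *)
have [n] := ubnP (size v); elim: n v => // n IHn [|[||k] [|[||j] v]] //= lt_vn.
- by move=> _; left; exists 0%N.
- move=> acc_v; right=> s s_gt0; apply/form2P; exists 0%N; eexists; split; last by [].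
  have [/(_ acc_v)[i [w [Fw def_w]]] _ _ _] := accepts_blocks s v s_gt0.
  by rewrite def_w; apply: (@blocks_run i.+2).
case/IHn=> [|[l ->]|form_v]; [by lia|by left; exists l.+1|right=> s s_gt0].
have /form2P[l [w [Bw def_v]]] := form_v s s_gt0.
apply/form2P; exists l.+1, w; split=> //.
by rewrite def_v.
Qed.

(** * The nonempty paths of the family are the closed accepted words *)

Lemma wpowUD_rcons l :
  wpow [:: U; D] l.+1 = rcons (wpow [:: U; D] l ++ [:: U]) (C 1).
Proof. by elim: l => // l IHl; rewrite wpowS {1}IHl. Qed.

Lemma calF_close_path v : accepts Ground v -> calF (close_path v).
Proof.
move=> acc_v; split; first exact: close_path_dyck.
have [_] := accepts_height _ _ 0 acc_v isT; rewrite add0r => end_v.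
case: (accepts_ground v acc_v) => [[l def_v]|form_v]; last first.
  by right; apply: form_v; lia.
have height_v : height v = 1.
  rewrite def_v; elim: l {def_v} => [|l IHl].
    by rewrite height_cons height_nil.
  by rewrite wpowS -catA !height_cons /= IHl.
by left; exists l.+1; rewrite /close_path height_v def_v wpowUD_rcons.
Qed.

Lemma calF_nonempty P : calF P -> P <> [::] ->
  exists2 v, accepts Ground v & P = close_path v.
Proof.
move=> [[_ height0 _] formP] P_neq0.
suff [v [s [def_P acc_v]]] : exists v s, P = rcons v (C s) /\ accepts Ground v.
  (* Ending on the x-axis forces [s] to be the height of [v]. *)
  exists v => //; rewrite def_P /close_path; congr (rcons v (C _)).
  by move: height0; rewrite def_P height_rcons rise_C; lia.
case: formP => [[[|k] def_P]|/form2P[l [w [/blocks_accepts[v [s [-> acc_v]]] ->]]]].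
- by case: P_neq0.
- exists (wpow [:: U; D] k ++ [:: U]), 1%N; rewrite accepts_wpowUD; split=> //.
  by rewrite def_P wpowUD_rcons.
- exists (wpow [:: U; D] l ++ v), s; rewrite rcons_cat accepts_wpowUD.
  by split=> //; apply: acc_v.
Qed.

Lemma calF_nil : calF [::].
Proof.
split; last by left; exists 0%N.
by split=> [n||[]] //; rewrite ?height_nil.
Qed.

(** * Counting accepted words by transfer between states *)

Fixpoint words (n : nat) : seq word :=
  if n is m.+1 then [seq U :: v | v <- words m] ++ [seq D :: v | v <- words m]
  else [:: [::]].

Lemma words_uniq n : uniq (words n).
Proof.
elim: n => //= n IHn; rewrite cat_uniq !map_inj_uniq ?IHn /= => [|? ? []|? ? []] //.
by rewrite andbT; apply/hasPn => _ /mapP[v _ ->]; apply/mapP => -[].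
Qed.

Lemma mem_words q v : accepts q v -> v \in words (size v).
Proof.
elim: v q => [|s v IHv] q; first by rewrite inE.
rewrite /= mem_cat.
by case: q s => -[|| k] //= /IHv mem_v; rewrite map_f ?orbT.
Qed.

Lemma size_words n v : v \in words n -> size v = n.
Proof.
elim: n v => [|n IHn] v; first by rewrite inE => /eqP->.
by rewrite mem_cat => /orP[] /mapP[w /IHn <- ->].
Qed.

Definition naccepts (q : state) (n : nat) : nat := count (accepts q) (words n).

Lemma ogf_calF0 : ogf calF 0%N = 1.
Proof.
rewrite /ogf (_ : of_length calF 0 = [set [::]]%classic).
  by rewrite fset_set1 cardfs1.
apply/seteqP; split=> P /=; first by case=> _ /size0nil.
by move=> ->; split=> //; apply: calF_nil.
Qed.

(** [close_path] maps the accepted words of length [n] bijectively onto the paths of length [n.+1];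
    the shift by one is the closing step. *)
Lemma ogf_calFS n : ogf calF n.+1 = (naccepts Ground n)%:Z.
Proof.
pose s := [seq close_path v | v <- words n & accepts Ground v].
rewrite /ogf (_ : of_length calF n.+1 = [set` [fset P in s]%fset]%classic).
  rewrite set_fsetK card_fseq undup_id ?size_map ?size_filter //.
  by rewrite map_inj_uniq ?filter_uniq ?words_uniq //; apply: close_path_inj.
apply/seteqP; split=> P /=; rewrite !inE.
  case=> FP sizeP; have [|v acc_v def_P] := calF_nonempty P FP.
    by move=> P0; rewrite P0 in sizeP.
  rewrite def_P; apply: map_f; rewrite mem_filter acc_v.
  by move: sizeP; rewrite def_P size_rcons => -[<-]; apply: mem_words acc_v.
case/mapP=> v; rewrite mem_filter => /andP[acc_v /size_words size_v] ->.
by split; [apply: calF_close_path|rewrite size_rcons size_v].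
Qed.

Lemma nacceptsS q n : naccepts q n.+1 =
  (count (fun v => accepts q (U :: v)) (words n) +
   count (fun v => accepts q (D :: v)) (words n))%N.
Proof. by rewrite /naccepts /= count_cat !count_map. Qed.

Lemma naccepts_ground n : naccepts Ground n.+1 = naccepts Odd n.
Proof. by rewrite nacceptsS [X in (_ + X)%N]count_pred0 addn0. Qed.

Lemma naccepts_odd n :
  naccepts Odd n.+1 = (naccepts Run n + naccepts Ground n)%N.
Proof. by rewrite nacceptsS. Qed.

Lemma naccepts_run n : naccepts Run n.+1 = (naccepts Run n + naccepts Down n)%N.
Proof. by rewrite nacceptsS. Qed.

Lemma naccepts_down n : naccepts Down n.+1 = (naccepts Run n + naccepts Low n)%N.
Proof. by rewrite nacceptsS. Qed.

Lemma naccepts_low n : naccepts Low n.+2 = naccepts Run n.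
Proof.
rewrite nacceptsS [X in (_ + X)%N]count_pred0 addn0 -/(naccepts LowU n.+1).
by rewrite nacceptsS [X in (_ + X)%N]count_pred0 addn0.
Qed.

(** From [n] to [n.+2] both sides grow by [naccepts Run n.+1 + naccepts Run n], so the cases 0 and 1
    suffice. This relation eliminates [Run] and [Low] and leaves a recurrence in [Ground] alone. *)
Lemma naccepts_run_low n : (naccepts Run n + naccepts Low n =
  naccepts Ground n.+1 + naccepts Ground n)%N.
Proof.
have [m] := ubnP n; elim: m n => // m IHm [|[|n]] // lt_nm.
have := IHm n ltac:(lia).
rewrite !(naccepts_low, naccepts_ground, naccepts_odd, naccepts_run, naccepts_down).
lia.
Qed.

Lemma naccepts_rec n : (naccepts Ground n.+4 =
  naccepts Ground n.+3 + naccepts Ground n.+2 + naccepts Ground n)%N.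
Proof.
have := naccepts_run_low n.
rewrite !(naccepts_ground, naccepts_odd, naccepts_run, naccepts_down).
lia.
Qed.

(** * The generating function *)

Lemma ogf_calF_mul :
  fps_mul (ogf calF) (fps_of_poly ('X^4 + 'X^2 + 'X - 1)) = fps_of_poly ('X - 1).
Proof.
rewrite fps_mulC; apply/funext => n; rewrite /fps_mul /fps_of_poly.
(* The coefficient 0 counts the empty path, not accepted words, so [naccepts_rec] applies only from
   the coefficient 5 on; the five lower ones are computed. *)
case: n => [|[|[|[|[|n]]]]].
1-5: by rewrite !big_ord_recl big_ord0 /= !coefE /= ?ogf_calFS ?ogf_calF0.
rewrite 5!big_ord_recl big1 => [|i _]; last by rewrite !coefE /= mul0r.
rewrite !coefE /= !subSS subn0 !ogf_calFS naccepts_rec !PoszD /bump /=.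
ring.
Qed.

Theorem theorem3p2 :
  ogf calF =
    fps_div (fps_of_poly ('X - 1 : {poly int}))
            (fps_of_poly (('X + 1) * ('X^3 - 'X^2 + 2 *: 'X - 1) : {poly int}))
  /\
  fps_eq_mod 12 (ogf calF)
    (fps_of_poly (1 + 'X^2 + 'X^3 + 3 *: 'X^4 + 4 *: 'X^5 + 8 *: 'X^6
       + 13 *: 'X^7 + 24 *: 'X^8 + 41 *: 'X^9 + 73 *: 'X^10
       + 127 *: 'X^11 : {poly int})).
Proof.
split.
  have -> : ('X + 1) * ('X^3 - 'X^2 + 2 *: 'X - 1) =
      'X^4 + 'X^2 + 'X - 1 :> {poly int}.
    by rewrite -mul_polyC; ring.
  (* The constant coefficient of the denominator is -1, a unit of [int]. *)
  by apply: fps_divP ogf_calF_mul; rewrite /fps_of_poly !coefE.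
case=> [_|n lt_n]; first by rewrite ogf_calF0 /fps_of_poly !coefE.
rewrite ogf_calFS /fps_of_poly.
(* Each of the coefficients 1 to 11 is evaluated by enumerating all words of the given length. *)
by do 11?[case: n lt_n => [_|n lt_n]; first by rewrite !coefE].
Qed.
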